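(* Let $\mathcal{T}$ be an embedded template in a $3$-space $X$ (that is, $X=\mathbb{R}^3$ or $X=S^3$), and let $\{h_\lambda\}_{\lambda\in I}$, $I=[0,1]$, be an ambient isotopy of $X$. Then the Kauffman invariants of the trivalent spatial graphs $\partial\mathcal{T}$ and $\partial h_1(\mathcal{T})$ are equal, i.e. $$\tau(\partial\mathcal{T})=\tau(\partial h_1(\mathcal{T}))$$ as sets of link types.
   Context: An ambient isotopy of a smooth manifold $X$ is a family of diffeomorphisms $\{h_\lambda\}_{\lambda\in I}$ of $X$, depending smoothly on $\lambda$, with $h_0=1_X$. A template $(\mathcal{T},\varphi_t)$ is a compact branched $2$-manifold $\mathcal{T}$ constructed from finitely many charts of two types, together with a semi-flow $\varphi_t$ on $\mathcal{T}$ (like a flow, except that one cannot go backward in time uniquely at a branch line). The two types of charts are joining charts (two incoming strips merge along a branch line, an interval, into one outgoing strip) and splitting charts (one incoming strip splits into two outgoing strips, separated by a gap). The gluing maps between charts (outgoing edges to incoming edges) respect the semi-flow and act linearly on the edges. An embedded template in $X$ is a template embedded in $X$. The boundary $\partial\mathcal{T}$ is the boundary of the branched surface, i.e. the closure of the set of points of $\mathcal{T}$ having a half-disc neighbourhood. It is a trivalent graph whose vertices are the endpoints of the branch lines (it may also have closed-loop components without vertices), and for $\mathcal{T}\subset X$ it is regarded as a trivalent spatial graph in $X$. Kauffman's invariant: let $G$ be a trivalent spatial graph in a $3$-space. A local replacement at a vertex $v$ chooses one of the three edge-ends at $v$, detaches it from $v$, and leaves the other two joined at $v$; so there are three types of local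 replacement at each vertex. $\tau(G)$ is the collection of knots and links obtained by making a local replacement, in all the possible ways, at each vertex of $G$ (keeping only the closed components and discarding the arcs). Two Kauffman invariants $\tau(G)$, $\tau(G')$ are equal if they are the same set of link types, where link types are taken up to ambient isotopy. *)

(* Defs.v *)
From Stdlib Require Import Relation_Operators.
From HB Require Import structures.
From mathcomp Require Import all_boot all_order all_algebra.
From mathcomp Require Import all_classical all_reals all_analysis.

Set Implicit Arguments.
Unset Strict Implicit.
Unset Printing Implicit Defensive.

Import Order.TTheory GRing.Theory Num.Theory.
Import numFieldNormedType.Exports.
Local Open Scope classical_set_scope.
Local Open Scope ring_scope.

(* Both 3-spaces are handled as subsets of a numerical space: R^3 as the whole
   of 'rV_3, and S^3 as the Euclidean unit sphere of 'rV_4 (the norm of 'rV_4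
   itself is the sup norm, so the sphere is given by its equation). *)
Variant space3 := R3 | S3.

Definition ambient_dim (s : space3) : nat :=
  match s with R3 => 3 | S3 => 4 end.

Definition carrier (R : realType) (s : space3) : set 'rV[R]_(ambient_dim s) :=
  match s with
  | R3 => setT
  | S3 => [set v : 'rV[R]_4 | \sum_(i < 4) v 0 i ^+ 2 = 1]
  end.

Arguments carrier R s _ : clear implicits.

Section Smooth.
Context {R : realType}.

(* The spaces V and W used below are finite-dimensional, and U is open. *)
Fixpoint Ck {V W : normedModType R} (k : nat) (U : set V) (f : V -> W) : Prop :=
  match k with
  | 0 => forall x, U x -> {for x, continuous f}
  | k'.+1 => (forall x, U x -> differentiable f x) /\
             forall v : V, Ck k' U ('D_v f)
  end.

(* Smoothness on an arbitrary subset: f is locally the restriction of a smooth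
   map defined on an open set. On a submanifold such as S^3, and on
   `[0, 1] times a submanifold, this is the usual notion. *)
Definition smooth_on {V W : normedModType R} (A : set V) (f : V -> W) : Prop :=
  forall x, A x -> exists (U : set V) (F : V -> W),
    [/\ open U, U x, forall k, Ck k U F & forall y, U y -> A y -> F y = f y].

Definition diffeomorphism_of {V : normedModType R} (X : set V) (f : V -> V) :=
  exists g : V -> V,
    [/\ set_fun X X f, set_fun X X g,
        {in X, cancel f g}, {in X, cancel g f} &
        smooth_on X f /\ smooth_on X g].

Definition ambient_isotopy {n : nat} (X : set 'rV[R]_n)
    (h : R -> 'rV[R]_n -> 'rV[R]_n) : Prop :=
  [/\ forall l, 0 <= l <= 1 -> diffeomorphism_of X (h l),
      smooth_on ((`[0, 1]%classic : set R^o) `*` X)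
        (fun q : R^o * 'rV[R]_n => h q.1 q.2) &
      forall x, X x -> h 0 x = x].

End Smooth.

Definition homeomorphism_onto {S T : topologicalType} (A : set S) (B : set T)
    (f : S -> T) : Prop :=
  exists g : T -> S,
    [/\ set_fun A B f, set_fun B A g,
        {in A, cancel f g}, {in B, cancel g f} &
        {within A, continuous f} /\ {within B, continuous g}].

(* Sheets index rectangles in the plane, with first coordinate across the strip
   and second coordinate along the semi-flow. A joining chart j is the union of
   two copies (j, b) of the unit square, identified where 1/2 <= y: the two
   incoming strips are the parts y <= 1/2, the branch line is y = 1/2, and the
   outgoing strip is the common part y >= 1/2. A splitting chart is the unit
   square minus the notch lying beyond y = 1/2, between its two outgoing
   strips.  Each sheet has exactly one incoming edge, y = 0. *)
Definition sheet (J S : finType) : Type := (J * bool + S)%type.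

Definition out_edge (J S : finType) : Type := (J + S * bool)%type.

Section Charts.
Context {R : realType} {J S : finType}.

Definition unit_square : set (R * R) :=
  [set z | 0 <= z.1 <= 1 /\ 0 <= z.2 <= 1].

Definition notch : set (R * R) :=
  [set z | 3^-1 < z.1 < 2 / 3 /\ 2^-1 < z.2].

Definition sheet_dom (c : sheet J S) : set (R * R) :=
  match c with
  | inl _ => unit_square
  | inr _ => unit_square `\` notch
  end.

(* Affine parametrizations of the edges by [0, 1]. *)
Definition in_point (c : sheet J S) (s : R) : sheet J S * (R * R) :=
  (c, (s, 0)).

Definition out_point (o : out_edge J S) (s : R) : sheet J S * (R * R) :=
  match o with
  | inl j => (inl (j, false), (s, 1))
  | inr (k, b) => (inr k, (if b then (2 + s) / 3 else s / 3, 1))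
  end.

Inductive glue_step (glue : out_edge J S -> sheet J S)
    (flip : out_edge J S -> bool) :
    sheet J S * (R * R) -> sheet J S * (R * R) -> Prop :=
| glue_branch j b b' x y : 0 <= x <= 1 -> 2^-1 <= y <= 1 ->
    glue_step glue flip (inl (j, b), (x, y)) (inl (j, b'), (x, y))
| glue_edge o s : 0 <= s <= 1 ->
    glue_step glue flip (out_point o s)
      (in_point (glue o) (if flip o then 1 - s else s)).

Definition glued glue flip := clos_refl_sym_trans _ (glue_step glue flip).

End Charts.

(* Since finitely many compact sheets cover a Hausdorff space, the conditions on
   charts say that tspace is the quotient of the disjoint union of the sheets by
   the gluing. The gluing matches all outgoing edges with all incoming
   edges, by affine maps (orientation-preserving or not). The semi-flow is only
   partially defined: flow (t, p) is meaningful when flow_dom (t, p) holds, and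
   orbits leave the template at the gaps of the splitting charts. *)
Record template (R : realType) := Template {
  tspace :> topologicalType;
  joins : finType;
  splits : finType;
  chart : sheet joins splits -> R * R -> tspace;
  glue : out_edge joins splits -> sheet joins splits;
  flip : out_edge joins splits -> bool;
  flow_dom : set (R * tspace);
  flow : R * tspace -> tspace;
  tspace_compact : compact [set: tspace];
  tspace_hausdorff : hausdorff_space tspace;
  glue_bij : bijective glue;
  chart_continuous : forall c, {within sheet_dom c, continuous (chart c)};
  chart_cover : forall p, exists c, (chart c @` sheet_dom c) p;
  chart_fiber : forall c z c' z', sheet_dom c z -> sheet_dom c' z' ->
    chart c z = chart c' z' <-> glued glue flip (c, z) (c', z');
  flow_dom_ge0 : forall t p, flow_dom (t, p) -> 0 <= t;
  flow_continuous : {within flow_dom, continuous flow};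
  flow_dom0 : forall p, flow_dom (0, p);
  flow0 : forall p, flow (0, p) = p;
  flow_domD : forall (s t : R) p, 0 <= s -> 0 <= t ->
    flow_dom (s + t, p) <-> flow_dom (s, p) /\ flow_dom (t, flow (s, p));
  flowD : forall (s t : R) p, 0 <= s -> 0 <= t -> flow_dom (s + t, p) ->
    flow (s + t, p) = flow (t, flow (s, p));
  flow_chart : forall c (x y y' : R), y < y' ->
    sheet_dom c (x, y) -> sheet_dom c (x, y') ->
    exists t : R, [/\ 0 < t, flow_dom (t, chart c (x, y)),
      flow (t, chart c (x, y)) = chart c (x, y') &
      forall s : R, 0 <= s <= t -> exists2 y'', y <= y'' <= y' &
        flow (s, chart c (x, y)) = chart c (x, y'')];
  flow_gap : forall k (x t : R), 3^-1 < x < 2 / 3 -> 0 < t ->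
    ~ flow_dom (t, chart (inr k) (x, 2^-1))
}.

Section Template.
Context {R : realType}.

(* As T is compact and V is Hausdorff, e is a homeomorphism onto its image. *)
Definition template_embedding {V : normedModType R} (X : set V)
    (T : template R) (e : T -> V) : Prop :=
  [/\ continuous e, injective e & range e `<=` X].

Definition branch_endpoints (T : template R) : set T :=
  [set p | exists (j : joins T) (x : R),
     (x = 0 \/ x = 1) /\ p = chart (inl (j, false)) (x, 2^-1)].

Definition half_disc : set (R * R) :=
  [set z | z.1 ^+ 2 + z.2 ^+ 2 < 1 /\ 0 <= z.2].

Definition half_disc_point {V : topologicalType} (A : set V) (p : V) : Prop :=
  A p /\ exists (U : set V) (f : V -> R * R),
    [/\ open U, U p, homeomorphism_onto (A `&` U) half_disc f & f p = (0, 0)].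

(* The intersection with A makes this the closure relative to A. *)
Definition surface_boundary {V : topologicalType} (A : set V) : set V :=
  A `&` closure (half_disc_point A).

Definition circle : set (R * R) := [set z | z.1 ^+ 2 + z.2 ^+ 2 = 1].

Definition tripod_leg (i : 'I_3) : set 'rV[R]_3 :=
  [set v | exists2 t : R, 0 < t < 1 & v = t *: delta_mx 0 i].

Definition tripod : set 'rV[R]_3 := [set 0] `|` \bigcup_i tripod_leg i.

End Template.

Arguments branch_endpoints {R} T _.
Arguments surface_boundary R {V} A _.

Record spatial_graph (V : Type) := SpatialGraph {
  support : set V;
  vertices : set V
}.

Definition boundary_graph {R : realType} {V : normedModType R}
    (T : template R) (e : T -> V) : spatial_graph V :=
  {| support := surface_boundary R (range e);
     vertices := e @` branch_endpoints T |}.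

Arguments boundary_graph {R V} T e.

Section Kauffman.
Context {R : realType} {n : nat}.
Local Notation V := 'rV[R]_n.
Implicit Types (X G L : set V).

(* A is the initial open segment, issuing from v, of one of the three edges at
   v. A loop based at v accounts for two edge-ends. *)
Definition edge_end (G : set V) (v : V) (A : set V) : Prop :=
  exists (U : set V) (f : V -> 'rV[R]_3) (i : 'I_3),
    [/\ open U, U v, homeomorphism_onto (G `&` U) tripod f, f v = 0 &
        A = G `&` U `&` f @^-1` tripod_leg i].

(* The union of those connected components that are simple closed curves. *)
Definition closed_components G : set V :=
  [set x | G x /\
     exists f : V -> R * R,
       homeomorphism_onto (connected_component G x) circle f].

(* Detaching an edge-end from v amounts to removing its initial open segment:
   the edge then ends away from v. The closed components do not depend on the
   lengths of the removed segments. The link may be empty. *)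
Definition replacement_link (G : spatial_graph V) (L : set V) : Prop :=
  exists A : V -> set V,
    (forall v, vertices G v -> edge_end (support G) v (A v)) /\
    L = closed_components (support G `\` \bigcup_(v in vertices G) A v).

Definition ambient_isotopic X (L L' : set V) : Prop :=
  exists2 h, ambient_isotopy X h & h 1 @` L = L'.

Definition link_type X (L : set V) : set (set V) :=
  [set L' | ambient_isotopic X L L'].

Definition kauffman X (G : spatial_graph V) : set (set (set V)) :=
  link_type X @` [set L | replacement_link G L].

End Kauffman.

(* Main.v *)
Require Import Defs.
From HB Require Import structures.
From mathcomp Require Import all_boot all_order all_algebra.
From mathcomp Require Import all_classical all_reals all_analysis.

Set Implicit Arguments.
Unset Strict Implicit.
Unset Printing Implicit Defensive.

Import Order.TTheory GRing.Theory Num.Theory.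
Import numFieldNormedType.Exports.
Local Open Scope classical_set_scope.
Local Open Scope ring_scope.

(** The theorem says that every ingredient of the Kauffman invariant is
    natural with respect to the ambient diffeomorphism h 1, and that
    link types do not see an ambient isotopy.

    Naturality is pure topology. The map h 1 and its inverse are mutually
    inverse homeomorphisms of the 3-space X, and half-disc points, the surface
    boundary, edge-ends, connected components and simple closed components of a
    subset of X are all defined from the subspace topology of X. Hence the
    boundary graph of h 1 \o e is the image of the boundary graph of e
    ([surface_boundary_image]), and L is a replacement link of a graph exactly
    when its image is a replacement link of the image graph
    ([replacement_link_image], used for h 1 and for its inverse).

    It remains that L and its image under h 1 have the same link type, that is,
    that being ambient isotopic is an equivalence relation. Transitivity is
    given by the levelwise composite k l \o h l of two isotopies. For symmetry,
    the naive inverse isotopy, made of the inverses of the h l, would need an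
    inverse function theorem to be smooth in the parameter; the isotopy
    h (1 - l) \o (h 1)^-1 also carries the image of L back to L
    ([ambient_isotopy_reverse]), and its smoothness only uses that of h and of
    the inverse of h 1. Both cases reduce to the fact that composites of smooth
    maps are smooth ([smooth_on_comp]). As smoothness is expressed by iterated
    directional derivatives, that fact is the chain rule written in
    coordinates,
      'D_v (g \o f) x = \sum_i (c i ('D_v f x)) *: 'D_(b i) g (f x),
    which allows an induction on the order of differentiability
    ([Ck_comp]). *)

(** * Calculus of Ck maps *)

(** Formulas for derivatives of composites and products only hold on an open
    set, so differentiability has to be transferred along equality near a point.
    It suffices to treat the difference, which vanishes near x and so is its own
    little-o remainder. *)
Lemma near_eq_differentiable {R : numFieldType} {V W : normedModType R}
    (f g : V -> W) (x : V) :
  (\near x, f x = g x) -> differentiable f x -> differentiable g x.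
Proof.
move=> fg df.
pose d := g - f.
have d0 : \forall y \near x, d y = 0.
  by apply: filterS fg => y fgy; rewrite /d !fctE fgy subrr.
suff dd : differentiable d x.
  rewrite (_ : g = f + d); first exact: differentiableD.
  by rewrite /d addrC subrK.
have dE : d \o shift x = cst (d x) + (0 : V -> W) +o_ 0 id.
  apply/eqaddoE; rewrite funeqE => y.
  rewrite !fctE (nbhs_singleton d0) !add0r.
  rewrite -[LHS]/((d \o shift x) y); congr (_ y).
  apply/eqoP => _/posnumP[e].
  have : \forall z \near 0, d (z + x) = 0.
    move: d0; rewrite (near_shift 0 x).
    by apply: filterS => z /=; rewrite subr0.
  by apply: filterS => z /= ->; rewrite normr0 mulr_ge0.
apply/diff_locallyP.
have d0c : continuous (0 : V -> W) by exact: cst_continuous.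
by rewrite (@diff_unique R V W d (\0 : {linear V -> W}) x).
Qed.

Lemma scale_is_bilinear {R : realType} (W : normedModType R) :
  bilinear_for
    (GRing.Scale.Law.clone _ _ *:%R _) (GRing.Scale.Law.clone _ _ *:%R _)
    (@GRing.scale R W : R^o -> W -> W).
Proof.
split=> [u'|u] a x y /=.
- by rewrite scalerDl scalerA.
- by rewrite scalerDr !scalerA mulrC.
Qed.

HB.instance Definition _ (R : realType) (W : normedModType R) :=
  bilinear_isBilinear.Build R R^o W W _ _
    (@GRing.scale R W : R^o -> W -> W) (scale_is_bilinear W).

Section CkCalculus.
Context {R : realType}.
Implicit Types V W Z : normedModType R.

Lemma differentiable_scale V W (a : V -> R^o) (f : V -> W) x :
  differentiable a x -> differentiable f x ->
  differentiable (fun y => a y *: f y) x /\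
  'd (fun y => a y *: f y) x =
    (fun v => a x *: 'd f x v + 'd a x v *: f x) :> (V -> W).
Proof.
move=> da df.
have sc : continuous (fun p : R^o * W => p.1 *: p.2) by exact: scale_continuous.
pose B : {bilinear R^o -> W -> W} := (@GRing.scale R W : R^o -> W -> W).
have dp := differentiable_pair da df.
have -> : (fun y => a y *: f y) =
  (fun p => B p.1 p.2) \o (fun y => (a y, f y)) by [].
have dB : differentiable (fun p => B p.1 p.2) (a x, f x).
  exact: differentiable_bilin.
split; first exact: differentiable_comp.
by rewrite diff_comp// diff_bilin// diff_pair// funeqE.
Qed.

Lemma Ck_eq V W k (U : set V) (f g : V -> W) :
  open U -> (forall x, U x -> f x = g x) -> Ck k U f -> Ck k U g.
Proof.
move=> oU; elim: k f g => [|k IH] f g fg /=.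
  move=> cf x Ux; have nfg : \near x, f x = g x.
    by near=> y; apply: fg; near: y; exact: open_nbhs_nbhs.
  rewrite /prop_for /continuous_at -(fg x Ux).
  exact: cvg_trans (near_eq_cvg nfg) (cf x Ux).
move=> [df Cf]; split=> [x Ux|v].
  apply: near_eq_differentiable (df x Ux).
  by near=> y; apply: fg; near: y; exact: open_nbhs_nbhs.
apply: IH (Cf v) => x Ux; apply: near_eq_derive.
by near=> y; apply: fg; near: y; exact: open_nbhs_nbhs.
Unshelve. all: by end_near. Qed.

Lemma Ck_subset V W k (U U' : set V) (f : V -> W) :
  U' `<=` U -> Ck k U f -> Ck k U' f.
Proof.
move=> sub; elim: k f => [|k IH] f /=; first by move=> cf x /sub; exact: cf.
by move=> [df Cf]; split=> [x /sub|v]; [exact: df|exact: IH].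
Qed.

Lemma CkS V W k (U : set V) (f : V -> W) : Ck k.+1 U f -> Ck k U f.
Proof.
elim: k f => [|k IH] f [df Cf].
  by move=> x Ux; exact/differentiable_continuous/df.
by split=> // v; exact: IH.
Qed.

Lemma Ck_cst V W k (U : set V) (a : W) : Ck k U (cst a).
Proof.
elim: k a => [|k IH] a /=; first by move=> x _; exact: cvg_cst.
split=> [x _|v]; first exact: differentiable_cst.
rewrite (_ : 'D_v (cst a) = cst 0); first exact: IH.
by rewrite funeqE => x; exact: derive_cst.
Qed.

Lemma CkD V W k (U : set V) (f g : V -> W) :
  open U -> Ck k U f -> Ck k U g -> Ck k U (f + g).
Proof.
move=> oU; elim: k f g => [|k IH] f g /=.
  by move=> cf cg x Ux; apply: continuousD; [exact: cf|exact: cg].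
move=> [df Cf] [dg Cg]; split=> [x Ux|v].
  by apply: differentiableD; [exact: df|exact: dg].
apply: Ck_eq (IH _ _ (Cf v) (Cg v)) => // x Ux.
by rewrite deriveD//; apply: diff_derivable; [exact: df|exact: dg].
Qed.

Lemma Ck_sum V W k (U : set V) (I : finType) (f : I -> V -> W) :
  open U -> (forall i, Ck k U (f i)) -> Ck k U (fun x => \sum_i f i x).
Proof.
move=> oU Cf; rewrite (_ : (fun x => _) = \sum_i f i).
  by elim/big_ind : _ => //; [exact: Ck_cst|move=> *; exact: CkD].
by rewrite funeqE => x; rewrite fct_sumE.
Qed.

Lemma Ck_linear V W Z k (U : set V) (l : {linear W -> Z}) (f : V -> W) :
  continuous l -> open U -> Ck k U f -> Ck k U (l \o f).
Proof.
move=> cl oU; elim: k f => [|k IH] f /=.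
  by move=> cf x Ux; apply: continuous_comp; [exact: cf|exact: cl].
move=> [df Cf].
have dl y : differentiable l y by exact: linear_differentiable.
split=> [x Ux|v].
  by apply: differentiable_comp => //; exact: df.
apply: Ck_eq (IH _ (Cf v)) => // x Ux.
have dfx := df x Ux.
rewrite /= (deriveE _ dfx) deriveE; last exact: differentiable_comp.
by rewrite (diff_comp dfx (dl (f x)))/= (diff_lin _ cl).
Qed.

Lemma Ck_scale V W k (U : set V) (a : V -> R^o) (f : V -> W) :
  open U -> Ck k U a -> Ck k U f -> Ck k U (fun x => a x *: f x).
Proof.
move=> oU; elim: k a f => [|k IH] a f.
  by move=> ca cf x Ux; apply: continuousZ; [exact: ca|exact: cf].
move=> Ca Cf; have [da Dka] := Ca; have [df Dkf] := Cf.
split=> [x Ux|v].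
  by case: (@differentiable_scale V W a f x (da x Ux) (df x Ux)).
have := CkD oU (IH _ _ (CkS Ca) (Dkf v)) (IH _ _ (Dka v) (CkS Cf)).
apply: Ck_eq => // x Ux.
have [? E] := @differentiable_scale V W a f x (da x Ux) (df x Ux).
by rewrite fctE (deriveE _ (da x Ux)) (deriveE _ (df x Ux)) deriveE// E.
Qed.

(** This is the form of finite-dimensionality that the chain rule below uses.
    The index type is arbitrary so that products are covered without
    reindexing. *)
Definition has_frame W := exists (I : finType) (b : I -> W)
    (c : I -> {linear W -> R^o}),
  (forall i, continuous (c i)) /\ forall w, w = \sum_i c i w *: b i.

(** The direction of differentiation of g varies with the point, whereas Ck
    speaks of derivatives along fixed vectors. Expanding it in a frame,
    'D_v (g \o f) x is the sum of the c i ('D_v f x) *: 'D_(b i) g (f x); each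
    term is the product of a coordinate of a derivative of f and of a composite
    to which the induction hypothesis applies. *)
Lemma Ck_comp V W Z k (U : set V) (U' : set W) (f : V -> W) (g : W -> Z) :
  has_frame W -> open U -> set_fun U U' f -> Ck k U f -> Ck k U' g ->
  Ck k U (g \o f).
Proof.
move=> [I [b [c [cc wE]]]] oU ff; elim: k f g ff => [|k IH] f g ff.
  move=> cf cg x Ux; apply: continuous_comp; first exact: cf.
  exact/cg/ff.
move=> Cf Cg; have [df Dkf] := Cf; have [dg Dkg] := Cg.
split=> [x Ux|v].
  by apply: differentiable_comp; [exact: df|exact/dg/ff].
have : Ck k U (fun x => \sum_i c i ('D_v f x) *: 'D_(b i) g (f x)).
  apply: Ck_sum => // i; apply: Ck_scale => //.
    exact: (@Ck_linear V W R^o k U (c i) _ (cc i) oU (Dkf v)).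
  exact: (IH f _ ff (CkS Cf) (Dkg (b i))).
apply: Ck_eq => // x Ux.
have dfx := df x Ux; have dgx := dg _ (ff _ Ux).
rewrite [RHS]deriveE; last exact: differentiable_comp.
rewrite (diff_comp dfx dgx)/= [X in _ = 'd g _ X]wE linear_sum.
by apply: eq_bigr => i _; rewrite linearZ !deriveE.
Qed.

Lemma has_frame_scalar : has_frame R^o.
Proof.
exists unit, (fun=> 1), (fun=> idfun); split=> [_|w].
  by move=> x; exact: cvg_id.
by rewrite big_const cardE enumT unlock/= addr0 /GRing.scale/= mulr1.
Qed.

Lemma has_frame_prod V W : has_frame V -> has_frame W -> has_frame (V * W)%type.
Proof.
move=> [I [b [c [cc wE]]]] [I' [b' [c' [cc' wE']]]].
exists (I + I')%type,
  (fun s => match s with inl i => (b i, 0) | inr i => (0, b' i) end),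
  (fun s => match s with
            | inl i => (c i \o fst : {linear _ -> _})
            | inr i => (c' i \o snd : {linear _ -> _})
            end).
split=> [[i|i]|w].
- by move=> x; apply: continuous_comp; [exact: cvg_fst|exact: cc].
- by move=> x; apply: continuous_comp; [exact: cvg_snd|exact: cc'].
rewrite big_sumType/=.
rewrite [LHS]surjective_pairing; congr pair.
  by rewrite /= !raddf_sum/= [X in _ + X]big1 ?addr0// => i _; rewrite scaler0.
by rewrite /= !raddf_sum/= big1 ?add0r// => i _; rewrite scaler0.
Qed.

Lemma has_frame_rV n : has_frame 'rV[R]_n.
Proof.
pose c (i : 'I_n) (v : 'rV[R]_n) : R^o := v 0 i.
have cl i : linear (c i : 'rV[R]_n -> R^o) by move=> a u v; rewrite /c !mxE.
pose C i : {linear 'rV[R]_n -> R^o} :=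
  HB.pack (c i) (GRing.isLinear.Build _ _ _ _ (c i) (cl i)).
exists 'I_n, (fun i => delta_mx 0 i), C; split=> [i|w].
  by move=> x; exact: coord_continuous.
by rewrite [LHS]row_sum_delta.
Qed.

End CkCalculus.

(** * Smooth maps on arbitrary subsets *)

Section SmoothMaps.
Context {R : realType}.
Implicit Types V W Z : normedModType R.

Lemma Ck_id V k (U : set V) : Ck k U (@idfun V).
Proof.
case: k => [|k]; first by move=> x _; exact: cvg_id.
split=> [x _|v]; first by have := is_diff_id x => -[].
rewrite (_ : 'D_v idfun = cst v); first exact: Ck_cst.
by rewrite funeqE => x; exact: derive_id.
Qed.

Lemma smooth_on_linear V W (A : set V) (l : {linear V -> W}) :
  continuous l -> smooth_on A l.
Proof.
move=> cl x _; exists setT, l; split=> //; first exact: openT.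
by move=> k; exact: (Ck_linear cl openT (Ck_id k setT)).
Qed.

Lemma smooth_on_comp V W Z (A : set V) (B : set W) (f : V -> W) (g : W -> Z) :
  has_frame W -> set_fun A B f -> smooth_on A f -> smooth_on B g ->
  smooth_on A (g \o f).
Proof.
move=> frW fAB sf sg x Ax.
have [U [F [oU Ux CF FE]]] := sf x Ax.
have [U' [G [oU' U'fx CG GE]]] := sg _ (fAB x Ax).
have oUF : open (U `&` F @^-1` U').
  have cF : {in U, continuous F} by move=> y /[!inE]; exact: (CF 0%N).
  exact: ((continuous_inP _ oU).1 cF).
exists (U `&` F @^-1` U'), (G \o F); split=> //.
- by split=> //=; rewrite FE.
- move=> k; apply: Ck_comp (CG k) => //; first by move=> y [].
  by apply: Ck_subset (CF k) => y [].
- by move=> y [Uy U'Fy] Ay; rewrite /= GE//= FE//; exact: fAB.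
Qed.

Lemma smooth_on_pair V W Z (A : set V) (f : V -> W) (g : V -> Z) :
  smooth_on A f -> smooth_on A g -> smooth_on A (fun x => (f x, g x)).
Proof.
move=> sf sg x Ax.
have [U [F [oU Ux CF FE]]] := sf x Ax.
have [U' [G [oU' U'x CG GE]]] := sg x Ax.
exists (U `&` U'), (fun x => (F x, G x)); split=> //.
- exact: openI.
- move=> k.
  (* A pair is the sum of the images of its components under the two linear
     injections into the product. *)
  pose inl_prod (w : W) : (W * Z)%type := (w, 0).
  pose inr_prod (z : Z) : (W * Z)%type := (0, z).
  have ll : linear inl_prod.
    by move=> a u v; congr pair; rewrite /= scaler0 addr0.
  have lr : linear inr_prod.
    by move=> a u v; congr pair; rewrite /= scaler0 addr0.
  pose il : {linear W -> (W * Z)%type} :=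
    HB.pack inl_prod (GRing.isLinear.Build _ _ _ _ inl_prod ll).
  pose ir : {linear Z -> (W * Z)%type} :=
    HB.pack inr_prod (GRing.isLinear.Build _ _ _ _ inr_prod lr).
  have cil : continuous il.
    by move=> w; apply: cvg_pair; [exact: cvg_id|exact: cvg_cst].
  have cir : continuous ir.
    by move=> w; apply: cvg_pair; [exact: cvg_cst|exact: cvg_id].
  have oI := openI oU oU'.
  have := CkD oI (Ck_linear cil oI (Ck_subset (@subIsetl _ _ _) (CF k)))
    (Ck_linear cir oI (Ck_subset (@subIsetr _ _ _) (CG k))).
  apply: Ck_eq => // y _.
  by rewrite fctE/=; congr pair; rewrite /= ?addr0 ?add0r.
- by move=> y [Uy U'y] Ay; rewrite FE// GE.
Qed.

Lemma smooth_onD V W (A : set V) (f g : V -> W) :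
  smooth_on A f -> smooth_on A g -> smooth_on A (f + g).
Proof.
move=> sf sg x Ax.
have [U [F [oU Ux CF FE]]] := sf x Ax.
have [U' [G [oU' U'x CG GE]]] := sg x Ax.
exists (U `&` U'), (F + G); split=> //.
- exact: openI.
- move=> k; apply: CkD; first exact: openI.
    by apply: Ck_subset (CF k); exact: subIsetl.
  by apply: Ck_subset (CG k); exact: subIsetr.
- by move=> y [Uy U'y] Ay; rewrite !fctE FE// GE.
Qed.

Lemma smooth_on_cst V W (A : set V) (a : W) : smooth_on A (cst a).
Proof.
move=> x _; exists setT, (cst a); split=> //; first exact: openT.
by move=> k; exact: Ck_cst.
Qed.

Lemma smooth_on_continuous V W (A : set V) (f : V -> W) :
  smooth_on A f -> {within A, continuous f}.
Proof.
move=> sf; apply/subspace_continuousP => x Ax.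
have [U [F [oU Ux CF FE]]] := sf x Ax.
suff : f @ within A (nbhs x) --> F x by rewrite (FE x Ux Ax).
have cF : F @ within A (nbhs x) --> F x.
  by apply: cvg_trans (CF 0%N x Ux); apply: cvg_fmap2; exact: cvg_within.
apply: cvg_trans cF; apply: near_eq_cvg.
have nU : nbhs x U by exact: open_nbhs_nbhs.
by apply: filterS nU => y Uy Ay; exact: FE.
Qed.

End SmoothMaps.

(** * Ambient isotopy is an equivalence relation *)

Section Isotopies.
Context {R : realType} {n : nat}.
Local Notation V := 'rV[R]_n.
Implicit Types (X L : set V) (f g : V -> V) (h k : R -> V -> V).

Lemma diffeomorphism_comp X f g : diffeomorphism_of X f ->
  diffeomorphism_of X g -> diffeomorphism_of X (g \o f).
Proof.
move=> [f' [fX f'X ff' f'f [sf sf']]] [g' [gX g'X gg' g'g [sg sg']]].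
exists (f' \o g'); split.
- by move=> x /fX /gX.
- by move=> x /g'X /f'X.
- by move=> x /[!inE] Xx /=; rewrite gg' ?inE ?ff' ?inE//; exact: fX.
- by move=> x /[!inE] Xx /=; rewrite f'f ?inE ?g'g ?inE//; exact: g'X.
- by split; [apply: smooth_on_comp sf sg | apply: smooth_on_comp sg' sf'] => //;
    exact: has_frame_rV.
Qed.

Lemma isotopy_set_fun X h : ambient_isotopy X h ->
  forall l, 0 <= l <= 1 -> set_fun X X (h l).
Proof. by move=> [dh _ _] l l01; have [g []] := dh l l01. Qed.

Lemma has_frame_cylinder : has_frame (R^o * V)%type.
Proof. exact: has_frame_prod has_frame_scalar (has_frame_rV n). Qed.

Lemma ambient_isotopy1 X h : ambient_isotopy X h -> diffeomorphism_of X (h 1).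
Proof. by move=> [+ _ _]; apply; rewrite ler01 lexx. Qed.

Lemma ambient_isotopy_comp X h k : ambient_isotopy X h -> ambient_isotopy X k ->
  ambient_isotopy X (fun l => k l \o h l).
Proof.
move=> ih ik; have hX := isotopy_set_fun ih.
have [dh sh h0] := ih; have [dk sk k0] := ik.
split=> [l l01||x Xx].
- exact: diffeomorphism_comp (dh l l01) (dk l l01).
- pose H (q : R^o * V) : R^o * V := (q.1, h q.1 q.2).
  apply: (@smooth_on_comp _ _ _ _ _ _ H (fun q => k q.1 q.2)
    has_frame_cylinder _ _ sk).
    by move=> [l x] [/= l01 Xx]; split=> //=; exact: hX.
  apply: smooth_on_pair => //.
  pose P : {linear (R^o * V)%type -> R^o} := fst.
  by apply: (@smooth_on_linear _ _ _ _ P) => x; exact: cvg_fst.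
- by rewrite /= h0// k0.
Qed.

(** Running h backwards and precomposing with the inverse g of h 1 starts at
    the identity and ends at g on X, without inverting any h l but h 1. *)
Lemma ambient_isotopy_reverse X h g : ambient_isotopy X h ->
  set_fun X X g -> {in X, cancel g (h 1)} -> {in X, cancel (h 1) g} ->
  smooth_on X g -> ambient_isotopy X (fun l => h (1 - l) \o g).
Proof.
move=> ih gX gh hg sg; have [dh sh h0] := ih.
have rev01 (l : R) : 0 <= l <= 1 -> 0 <= 1 - l <= 1.
  by move=> /andP[l0 l1]; rewrite subr_ge0 l1 gerBl.
have dg : diffeomorphism_of X g.
  have [g' [h1X _ _ _ [sh1 _]]] := ambient_isotopy1 ih.
  by exists (h 1); split.
split=> [l l01||x Xx].
- exact: diffeomorphism_comp dg (dh _ (rev01 l l01)).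
- pose H (q : R^o * V) : R^o * V := (1 - q.1, g q.2).
  apply: (@smooth_on_comp _ _ _ _ _ _ H (fun q => h q.1 q.2)
    has_frame_cylinder _ _ sh).
    move=> [l x] [/= l01 Xx]; split=> /=; last exact: gX.
    by move: l01; rewrite !in_itv; exact: rev01.
  apply: smooth_on_pair.
    pose N : {linear (R^o * V)%type -> R^o} := -%R \o fst.
    apply: (@smooth_onD _ _ _ _ (cst (1 : R^o)) N); first exact: smooth_on_cst.
    apply: smooth_on_linear => x; apply: continuous_comp; first exact: cvg_fst.
    exact: opp_continuous.
  apply: (@smooth_on_comp _ _ _ _ _ X snd g) => //.
  + exact: has_frame_rV.
  + by move=> [l x] [].
  + pose P : {linear (R^o * V)%type -> V} := snd.
    by apply: (@smooth_on_linear _ _ _ _ P) => x; exact: cvg_snd.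
- by rewrite /= subr0 gh// inE.
Qed.

Lemma ambient_isotopic_trans X L L' L'' : ambient_isotopic X L L' ->
  ambient_isotopic X L' L'' -> ambient_isotopic X L L''.
Proof.
move=> [h ih <-] [k ik <-]; exists (fun l => k l \o h l).
  exact: ambient_isotopy_comp.
by rewrite image_comp.
Qed.

Lemma ambient_isotopic_sym X L L' : L `<=` X -> ambient_isotopic X L L' ->
  ambient_isotopic X L' L.
Proof.
move=> LX [h ih <-]; have [_ _ h0] := ih.
have [g [_ gX hg gh [_ sg]]] := ambient_isotopy1 ih.
exists (fun l => h (1 - l) \o g); first exact: ambient_isotopy_reverse.
rewrite subrr image_comp -[RHS]image_id; apply: eq_imagel => x /LX Xx /=.
by rewrite hg ?inE// h0.
Qed.

Lemma link_type_eq X L L' : L `<=` X -> ambient_isotopic X L L' ->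
  link_type X L = link_type X L'.
Proof.
move=> LX LL'; apply/seteqP; split=> L''; last exact: ambient_isotopic_trans.
exact/ambient_isotopic_trans/ambient_isotopic_sym.
Qed.

End Isotopies.

(** * Topological naturality of the boundary graph and of its links *)

(** [homeomorphism_onto] with its inverse made explicit, which makes the notion
    symmetric: each inclusion proved below for phi also holds for its inverse,
    and together they give the equalities. *)
Definition mutual_homeomorphisms {S T : topologicalType} (A : set S) (B : set T)
    (f : S -> T) (g : T -> S) : Prop :=
  [/\ set_fun A B f, set_fun B A g, {in A, cancel f g}, {in B, cancel g f} &
      {within A, continuous f} /\ {within B, continuous g}].

Lemma mutual_homeomorphisms_sym (S T : topologicalType)
    (A : set S) (B : set T) f g :
  mutual_homeomorphisms A B f g -> mutual_homeomorphisms B A g f.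
Proof. by move=> [fAB gBA fK gK [cf cg]]. Qed.

Lemma within_continuous_comp (S T U : topologicalType) (A : set S) (B : set T)
    (f : S -> T) (g : T -> U) : set_fun A B f ->
  {within A, continuous f} -> {within B, continuous g} ->
  {within A, continuous (g \o f)}.
Proof.
move=> fAB /subspace_continuousP cf /subspace_continuousP cg.
apply/subspace_continuousP => x Ax N nN.
have := cf x Ax _ (cg _ (fAB x Ax) N nN).
by rewrite /nbhs/=/within/=; apply: filterS => y /= h Ay; exact/h/fAB.
Qed.

Lemma mutual_homeomorphisms_comp (S T U : topologicalType)
    (A : set S) (B : set T) (C : set U) f f' g g' :
  mutual_homeomorphisms A B f f' -> mutual_homeomorphisms B C g g' ->
  mutual_homeomorphisms A C (g \o f) (f' \o g').
Proof.
move=> [fAB f'BA fK f'K [cf cf']] [gBC g'CB gK g'K [cg cg']]; split.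
- by move=> x /fAB /gBC.
- by move=> x /g'CB /f'BA.
- by move=> x /[!inE] Ax /=; rewrite gK ?fK ?inE//; exact: fAB.
- by move=> x /[!inE] Cx /=; rewrite f'K ?g'K ?inE//; exact: g'CB.
- split; first exact: within_continuous_comp cf cg.
  exact: within_continuous_comp cg' cf'.
Qed.

Lemma diffeomorphism_homeomorphism (R : realType) (V : normedModType R)
    (X : set V) (f : V -> V) :
  diffeomorphism_of X f -> exists g, mutual_homeomorphisms X X f g.
Proof.
move=> [g [fX gX fK gK [sf sg]]]; exists g; split=> //.
by split; exact: smooth_on_continuous.
Qed.

Section Transport.
Context {S T : topologicalType} {X : set S} {Y : set T}.
Context {phi : S -> T} {psi : T -> S}.
Hypothesis hphi : mutual_homeomorphisms X Y phi psi.

Let phiK x : X x -> psi (phi x) = x.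
Proof. by move=> Xx; have [_ _ -> //] := hphi; rewrite inE. Qed.

Let phiXY x : X x -> Y (phi x).
Proof. by have [+ _ _ _ _] := hphi; exact. Qed.

Lemma mutual_homeomorphisms_image A : A `<=` X ->
  mutual_homeomorphisms A (phi @` A) phi psi.
Proof.
move=> AX; have [_ _ _ _ [cphi cpsi]] := hphi; split.
- by move=> x Ax; exists x.
- by move=> _ [x Ax <-]; rewrite phiK//; exact: AX.
- by move=> x /[!inE] /AX; exact: phiK.
- by move=> y /[!inE] -[x /AX Xx <-]; rewrite phiK.
- split; first exact: continuous_subspaceW cphi.
  by apply: continuous_subspaceW cpsi => _ [x /AX + <-]; exact: phiXY.
Qed.

Lemma image_imageK A : A `<=` X -> psi @` (phi @` A) = A.
Proof.
move=> AX; rewrite image_comp -[RHS]image_id.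
by apply: eq_imagel => x /AX /phiK.
Qed.

Lemma image_sub_codom A : A `<=` X -> phi @` A `<=` Y.
Proof. by move=> AX _ [x /AX + <-]; exact: phiXY. Qed.

(** X need not be open, so phi need not map open sets to open sets: U' only
    agrees with the image of U on Y, which is all that local properties of
    subsets of X require. *)
Lemma open_image (U : set S) : open U ->
  exists2 U', open U' & forall x, X x -> U' (phi x) <-> U x.
Proof.
move=> oU; have [_ _ _ _ [_ /subspace_continuousP cpsi]] := hphi.
(* The interior is taken after adding the complement of Y, because the preimage
   of U under psi is only a neighbourhood relatively to Y. *)
exists ([set y | Y y -> U (psi y)]^°); first exact: open_interior.
move=> x Xx; split=> [/interior_subset/(_ (phiXY Xx))|Ux].
  by rewrite phiK.
have nU : nbhs (psi (phi x)) U by rewrite phiK//; exact: open_nbhs_nbhs.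
exact: (cpsi _ (phiXY Xx) U nU).
Qed.

Lemma image_setI_open A U U' : A `<=` X ->
  (forall x, X x -> U' (phi x) <-> U x) ->
  (phi @` A) `&` U' = phi @` (A `&` U).
Proof.
move=> AX UU'; apply/seteqP; split=> [_ [[x Ax <-]]|_ [x [Ax Ux] <-]].
  by move=> /(UU' _ (AX _ Ax)); exists x.
by split; [exists x|apply/UU' => //; exact: AX].
Qed.

Lemma half_disc_point_image (R : realType) A p : A `<=` X ->
  half_disc_point (R := R) A p -> half_disc_point (R := R) (phi @` A) (phi p).
Proof.
move=> AX [Ap [U [f [oU Up [g hfg] fp]]]]; split; first by exists p.
have [U' oU' UU'] := open_image oU.
have Xp := AX _ Ap.
exists U', (f \o psi); split=> //; [exact/UU'| |by rewrite /= phiK].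
exists (phi \o g); rewrite (image_setI_open AX UU').
apply: mutual_homeomorphisms_comp hfg.
by apply/mutual_homeomorphisms_sym/mutual_homeomorphisms_image => x [/AX].
Qed.

Lemma surface_boundary_image_sub (R : realType) A : A `<=` X ->
  phi @` surface_boundary R A `<=` surface_boundary R (phi @` A).
Proof.
move=> AX _ [x [Ax clx] <-]; split; first by exists x.
have [_ _ _ _ [/subspace_continuousP cphi _]] := hphi.
move=> N /(cphi _ (AX _ Ax)) nN.
have [y [hy Ny]] := clx _ nN.
exists (phi y); split; first exact: half_disc_point_image.
by apply: Ny; apply: AX; case: hy.
Qed.

Lemma connected_component_image_sub A x : A `<=` X ->
  phi @` connected_component A x `<=` connected_component (phi @` A) (phi x).
Proof.
move=> AX _ [y [C [Cx CA cC] Cy] <-].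
exists (phi @` C); last by exists y.
split; [by exists x|exact: image_subset|].
apply: connected_continuous_connected => //.
have [_ _ _ _ [cphi _]] := hphi.
by apply: continuous_subspaceW cphi => z /CA /AX.
Qed.

End Transport.

Section TransportEq.
Context {S T : topologicalType} {X : set S} {Y : set T}.
Context {phi : S -> T} {psi : T -> S}.
Hypothesis hphi : mutual_homeomorphisms X Y phi psi.
Let hpsi := mutual_homeomorphisms_sym hphi.

Lemma surface_boundary_image (R : realType) A : A `<=` X ->
  surface_boundary R (phi @` A) = phi @` surface_boundary R A.
Proof.
move=> AX; apply/seteqP; split; last exact: (surface_boundary_image_sub hphi).
move=> y yb; have AY := image_sub_codom hphi AX.
have Yy : Y y by apply: AY; case: yb.
have := @surface_boundary_image_sub _ _ _ _ _ _ hpsi R _ AY (psi y).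
rewrite (image_imageK hphi AX) => /(_ (ex_intro2 _ _ y yb erefl)) h.
exists (psi y) => //.
by have [_ _ _ -> //] := hphi; rewrite inE.
Qed.

Lemma connected_component_image A x : A `<=` X -> A x ->
  connected_component (phi @` A) (phi x) = phi @` connected_component A x.
Proof.
move=> AX Ax; apply/seteqP; split.
  2: exact: (connected_component_image_sub hphi).
move=> y yc; have AY := image_sub_codom hphi AX.
have Yy : Y y by apply: AY; exact: connected_component_sub yc.
have := @connected_component_image_sub _ _ _ _ _ _ hpsi _ (phi x) AY (psi y).
have [_ _ phiK psiK _] := hphi.
rewrite (image_imageK hphi AX) phiK ?inE; last exact: AX.
move=> /(_ (ex_intro2 _ _ y yc erefl)) h.
by exists (psi y) => //; rewrite psiK ?inE.
Qed.

End TransportEq.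

Section TransportGraph.
Context {R : realType} {n : nat} {X Y : set 'rV[R]_n}.
Context {phi psi : 'rV[R]_n -> 'rV[R]_n}.
Hypothesis hphi : mutual_homeomorphisms X Y phi psi.
Local Notation V := 'rV[R]_n.
Implicit Types A B : set V.

Lemma edge_end_image A B v : A `<=` X ->
  X v -> edge_end A v B -> edge_end (phi @` A) (phi v) (phi @` B).
Proof.
move=> AX Xv [U [f [i [oU Uv [g hfg] fv ->]]]].
have [_ _ phiK _ _] := hphi.
have [U' oU' UU'] := open_image hphi oU.
exists U', (f \o psi), i; split=> //.
- exact/UU'.
- exists (phi \o g); rewrite (image_setI_open AX UU').
  apply: mutual_homeomorphisms_comp hfg.
  apply/mutual_homeomorphisms_sym/(mutual_homeomorphisms_image hphi).
  by move=> x [/AX].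
- by rewrite /= phiK ?inE.
- rewrite (image_setI_open AX UU'); apply/seteqP; split.
    move=> _ [x [[Ax Ux] fx] <-].
    by split; [exists x|rewrite /= phiK ?inE//; exact: AX].
  move=> _ [[x [Ax Ux] <-]]; rewrite /= phiK ?inE; last exact: AX.
  by exists x.
Qed.

(** Being a simple closed curve is a property of the homeomorphism type of a
    connected component, and components correspond under phi. *)
Lemma closed_components_image_sub A : A `<=` X ->
  phi @` closed_components A `<=` closed_components (phi @` A).
Proof.
move=> AX _ [x [Ax [f [g hfg]]] <-]; split; first by exists x.
exists (f \o psi), (phi \o g).
rewrite (connected_component_image hphi AX Ax).
apply: mutual_homeomorphisms_comp hfg.
apply/mutual_homeomorphisms_sym/(mutual_homeomorphisms_image hphi) => y.
by move/connected_component_sub/AX.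
Qed.

End TransportGraph.

Section TransportLink.
Context {R : realType} {n : nat} {X Y : set 'rV[R]_n}.
Context {phi psi : 'rV[R]_n -> 'rV[R]_n}.
Hypothesis hphi : mutual_homeomorphisms X Y phi psi.
Let hpsi := mutual_homeomorphisms_sym hphi.
Local Notation V := 'rV[R]_n.
Implicit Types (A L : set V) (G : spatial_graph V).

Lemma closed_components_image A : A `<=` X ->
  closed_components (phi @` A) = phi @` closed_components A.
Proof.
move=> AX; apply/seteqP; split; last exact: (closed_components_image_sub hphi).
move=> y yc; have AY := image_sub_codom hphi AX.
have Yy : Y y by apply: AY; case: yc.
have := @closed_components_image_sub _ _ _ _ _ _ hpsi _ AY (psi y).
rewrite (image_imageK hphi AX) => /(_ (ex_intro2 _ _ y yc erefl)) h.
exists (psi y) => //.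
by have [_ _ _ -> //] := hphi; rewrite inE.
Qed.

Definition image_graph (h : V -> V) G : spatial_graph V :=
  SpatialGraph (h @` Defs.support G) (h @` vertices G).

Lemma replacement_link_sub G L : replacement_link G L -> L `<=` Defs.support G.
Proof. by move=> [A [_ ->]] x [[]]. Qed.

(** The edge-end removed at phi v is the image of the one removed at v; as phi
    is injective on X, removing edge-ends commutes with taking images. *)
Lemma replacement_link_image G L : Defs.support G `<=` X -> vertices G `<=` X ->
  replacement_link G L -> replacement_link (image_graph phi G) (phi @` L).
Proof.
move=> GX vX [A [eA ->]]; have [_ _ phiK _ _] := hphi.
exists (fun w => phi @` A (psi w)); split.
  move=> _ [v Gv <-] /=; rewrite phiK ?inE; last exact: vX.
  by apply: (edge_end_image hphi) => //; [exact: vX|exact: eA].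
rewrite -closed_components_image; last by move=> x [/GX].
congr closed_components; apply/seteqP.
split=> [_ [x [Gx nAx] <-]|_ [[x Gx <-] nAx]].
  split; first by exists x.
  move=> [_ [v Gv <-]]; rewrite phiK ?inE; last exact: vX.
  move=> [z Az zx]; apply: nAx; exists v => //.
  have Xz : X z.
    have [U [f [i [_ _ _ _ AE]]]] := eA v Gv.
    by move: Az; rewrite AE => -[[/GX]].
  by rewrite -(phiK x) ?inE; [rewrite -zx phiK ?inE|exact: GX].
exists x => //; split=> // -[v Gv Avx]; apply: nAx.
exists (phi v); first by exists v.
by rewrite phiK ?inE; [exists x|exact: vX].
Qed.

End TransportLink.

(** The map L |-> h 1 @` L is a bijection between the replacement links of G and
    those of its image, and it preserves link types. *)
Lemma kauffman_image (R : realType) (n : nat) (X : set 'rV[R]_n)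
    (h : R -> 'rV[R]_n -> 'rV[R]_n) (G : spatial_graph 'rV[R]_n) :
  ambient_isotopy X h -> Defs.support G `<=` X -> vertices G `<=` X ->
  kauffman X (image_graph (h 1) G) = kauffman X G.
Proof.
move=> ih GX vX.
have [g hhg] := diffeomorphism_homeomorphism (ambient_isotopy1 ih).
have hgh := mutual_homeomorphisms_sym hhg.
have lt L : L `<=` X -> link_type X (h 1 @` L) = link_type X L.
  by move=> LX; apply/esym/link_type_eq => //; exists h.
apply/seteqP; split=> [_ [L' rL' <-]|_ [L rL <-]].
  have hGX : Defs.support (image_graph (h 1) G) `<=` X.
    exact: (image_sub_codom hhg).
  have L'X := subset_trans (replacement_link_sub rL') hGX.
  exists (g @` L').
    have := replacement_link_image hgh hGX (image_sub_codom hhg vX) rL'.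
    by rewrite /image_graph/= !(image_imageK hhg)//.
  rewrite -(lt (g @` L')) ?(image_imageK hgh)//.
  exact: (image_sub_codom hgh).
exists (h 1 @` L); first exact: (replacement_link_image hhg).
by rewrite lt//; exact: subset_trans (replacement_link_sub rL) GX.
Qed.

Theorem theorem2 (R : realType) (s : space3) (T : template R)
    (e : T -> 'rV[R]_(ambient_dim s))
    (h : R -> 'rV[R]_(ambient_dim s) -> 'rV[R]_(ambient_dim s)) :
  template_embedding (carrier R s) e ->
  ambient_isotopy (carrier R s) h ->
  kauffman (carrier R s) (boundary_graph T e) =
  kauffman (carrier R s) (boundary_graph T (h 1 \o e)).
Proof.
move=> [_ _ eX] ih; set X := carrier R s.
have [g hhg] := diffeomorphism_homeomorphism (ambient_isotopy1 ih).
have -> : boundary_graph T (h 1 \o e) = image_graph (h 1) (boundary_graph T e).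
  rewrite /boundary_graph /image_graph /=; congr SpatialGraph.
    by rewrite -(surface_boundary_image hhg)// image_comp.
  by rewrite image_comp.
apply/esym/kauffman_image => //=.
  by move=> x [/eX].
by move=> _ [p _ <-]; apply: eX; exists p.
Qed.
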